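(* Let $R$ be a superrigid directed cr-qsring, with the associated commutative ring extension $A_R\subseteq B_R$. Then $R$ is a Prüfer cr-qsring (i.e. $A_R\subseteq B_R$ is a Prüfer extension) if and only if for all $\varphi\in B_R$ there exists $\psi\in B_R$ such that $\psi(\gamma^2)\le\varphi(\gamma)^{-1}$, where $\gamma:=v(\varphi(\varepsilon))^{-1}$.
   Context: A commutative semigroup $S$ is regular if each $x\in S$ has some $y$ with $x^2y=x$; then there is a unique quasi-inverse $x^{-1}$ with $x^2x^{-1}=x$, $(x^{-1})^2x=x^{-1}$. A cr-qsring (commutative regular quasi-semiring) is an algebra $(R,+,\bullet,-,{}^{-1},\varepsilon)$ of signature $(2,2,1,1,0)$ such that, writing $e^+(x):=x+(-x)$, $e^\bullet(x):=x\bullet x^{-1}$, $E^+:=\{x: x+x=x\}$, $E^\bullet:=\{x: x\bullet x=x\}$ and $x\le y :\Leftrightarrow x=y+e^+(x)$: (1) $(R,+)$ and $(R,\bullet)$ are commutative regular semigroups with quasi-inverses $-x$ and $x^{-1}$; (2) $E^+\cap E^\bullet=\{\varepsilon\}$; (3') $x\bullet y+x\bullet z\le x\bullet(y+z)$; (4) $y\le z\Rightarrow x\bullet y\le x\bullet z$; (5) $-(x\bullet y)=x\bullet(-y)$; (6) $e^+(x+y)\le e^+(x\bullet y)$ for $x,y\in E^\bullet$. Put $v(x):=\varepsilon\bullet x\in E^+$. Then $\Lambda:=(E^+,\bullet,\wedge,\vee)$, with $e\wedge f=e+f$, $e\vee f=(e^{-1}+f^{-1})^{-1}$, is an Abelian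 $l$-group with neutral element $\varepsilon$ and order $\le$; $\Lambda_+=\{\alpha\in\Lambda:\alpha\ge\varepsilon\}$; powers such as $\gamma^2$ are with respect to $\bullet$. $R$ is directed if $\varepsilon\le x$ for all $x\in E^\bullet$. A directed cr-qsring is superrigid if the (always injective) map $e^+|_{E^\bullet}:E^\bullet\to\Lambda_+$ is surjective; $1_\alpha$ denotes the unique element of $E^\bullet$ with $e^+(1_\alpha)=\alpha$. For superrigid $R$, $B_R$ is the set of maps $\varphi:\Lambda_+\to R$ with $e^+(\varphi(\alpha))=\alpha$ for all $\alpha$ and $\varphi(\alpha)\le\varphi(\beta)$ for $\alpha\le\beta$; it is a commutative unital ring with pointwise $+,-$, zero $\alpha\mapsto\alpha$, unit $\alpha\mapsto1_\alpha$, and product $(\varphi\cdot\psi)(\alpha)=\varphi(\alpha\bullet v(\psi(\varepsilon))^{-1})\bullet\psi(\alpha\bullet v(\varphi(\varepsilon))^{-1})+\alpha$. $A_R:=\{\varphi\in B_R:\varphi(\varepsilon)=\varepsilon\}$ is a subring (the $l$-valuation ring of the $l$-valuation $\varphi\mapsto v\circ\varphi$). A commutative unital ring extension $A\subseteq B$ is Prüfer if every subring of $B$ containing $A$ is integrally closed in $B$; equivalently, for every $x\in B$ there is $y\in A$ with $xy\in A$ and $x(1-xy)\in A$. *)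

(* Defs.v *)
From HB Require Import structures.
From mathcomp Require Import all_boot ssralg boolp.

Set Implicit Arguments.
Unset Strict Implicit.
Unset Printing Implicit Defensive.

Declare Scope qs_scope.
Delimit Scope qs_scope with qs.

(* The bare signature (2,2,1,1,0).  The operations are kept apart from those
   of [GRing]: [+] has no neutral element here and [-] is only a
   quasi-inverse.  Classically every type carries a choiceType structure, so
   [Choice] is not a restriction. *)
HB.mixin Record hasQsOps R of Choice R := {
  qadd : R -> R -> R;
  qmul : R -> R -> R;
  qopp : R -> R;
  qinv : R -> R;
  qeps : R
}.

#[short(type="qsAlgType")]
HB.structure Definition QsAlg := {R of Choice R & hasQsOps R}.

Notation "x + y" := (qadd x y) : qs_scope.
Notation "x * y" := (qmul x y) : qs_scope.
Notation "- x" := (qopp x) : qs_scope.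
Notation "x ^-1" := (qinv x) : qs_scope.
Notation "'\eps'" := (@qeps _) (at level 0) : qs_scope.

Local Open Scope qs_scope.

Definition eadd (R : qsAlgType) (x : R) : R := x + - x.
Definition emul (R : qsAlgType) (x : R) : R := x * x^-1.

Definition Eadd (R : qsAlgType) : {pred R} := [pred x | x + x == x].
Definition Emul (R : qsAlgType) : {pred R} := [pred x | x * x == x].
Arguments Eadd R : clear implicits.
Arguments Emul R : clear implicits.

Definition qle (R : qsAlgType) (x y : R) : bool := x == y + eadd x.
Notation "x <= y" := (qle x y) : qs_scope.

HB.mixin Record isCrQsring R of QsAlg R := {
  qaddA : associative (@qadd R);
  qaddC : commutative (@qadd R);
  qaddxxN : forall x : R, x + x + - x = x;
  qaddNNx : forall x : R, - x + - x + x = - x;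
  qmulA : associative (@qmul R);
  qmulC : commutative (@qmul R);
  qmulxxV : forall x : R, x * x * x^-1 = x;
  qmulVVx : forall x : R, x^-1 * x^-1 * x = x^-1;
  Eadd_Emul : forall x : R, (x \in Eadd R) && (x \in Emul R) = (x == \eps);
  qmulD_le : forall x y z : R, x * y + x * z <= x * (y + z);
  qmul_mono : forall x y z : R, y <= z -> x * y <= x * z;
  qmulN : forall x y : R, - (x * y) = x * - y;
  eaddD_le_mul : forall x y : R, x \in Emul R -> y \in Emul R ->
    eadd (x + y) <= eadd (x * y)
}.

#[short(type="crQsringType")]
HB.structure Definition CrQsring := {R of QsAlg R & isCrQsring R}.
Arguments qmul_mono {s} x {y z} _.

Definition qval (R : qsAlgType) (x : R) : R := \eps * x.

Definition Lam_pos (R : qsAlgType) : {pred R} :=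
  [pred a | (a \in Eadd R) && (\eps <= a)].
Arguments Lam_pos R : clear implicits.

HB.mixin Record isDirectedQsring R of CrQsring R := {
  eps_le_Emul : forall x : R, x \in Emul R -> \eps <= x
}.

#[short(type="directedCrQsringType")]
HB.structure Definition DirectedCrQsring :=
  {R of CrQsring R & isDirectedQsring R}.

HB.mixin Record isSuperrigid R of DirectedCrQsring R := {
  eadd_surj : forall a : R, a \in Lam_pos R ->
    exists x : R, (x \in Emul R) && (eadd x == a)
}.

#[short(type="superrigidType")]
HB.structure Definition Superrigid := {R of DirectedCrQsring R & isSuperrigid R}.

Section QuasiInverse.
Variables (T : Type) (op : T -> T -> T).
Hypotheses (opA : associative op) (opC : commutative op).

Lemma quasi_inv_uniq x y z :
  op (op x x) y = x -> op (op y y) x = y ->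
  op (op x x) z = x -> op (op z z) x = z -> y = z.
Proof.
have aux u w : op (op u u) x = u -> op (op x x) w = x -> u = op (op u x) w.
  move=> Hu Hw; transitivity (op (op u u) (op (op x x) w)).
    by rewrite Hw Hu.
  by rewrite !opA Hu.
move=> xy yx xz zx; rewrite (aux y z) // [RHS](aux z y) //.
by rewrite -opA opC; congr op; apply: opC.
Qed.
End QuasiInverse.

Section Theory.
Variable R : crQsringType.
Implicit Types (x y z a b c d : R).

Lemma qaddCA : left_commutative (@qadd R).
Proof. by move=> x y z; rewrite !qaddA (qaddC x). Qed.
Lemma qaddAC : right_commutative (@qadd R).
Proof. by move=> x y z; rewrite -!qaddA (qaddC y). Qed.
Lemma qaddACA : interchange (@qadd R) (@qadd R).
Proof. by move=> x y z t; rewrite -!qaddA (qaddCA y). Qed.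
Lemma qmulCA : left_commutative (@qmul R).
Proof. by move=> x y z; rewrite !qmulA (qmulC x). Qed.
Lemma qmulAC : right_commutative (@qmul R).
Proof. by move=> x y z; rewrite -!qmulA (qmulC y). Qed.
Lemma qmulACA : interchange (@qmul R) (@qmul R).
Proof. by move=> x y z t; rewrite -!qmulA (qmulCA y). Qed.

Lemma EaddP a : reflect (a + a = a) (a \in Eadd R).
Proof. by rewrite inE; apply: eqP. Qed.
Lemma EmulP a : reflect (a * a = a) (a \in Emul R).
Proof. by rewrite inE; apply: eqP. Qed.
Lemma qleP x y : reflect (x = y + eadd x) (x <= y).
Proof. exact: eqP. Qed.

Lemma qoppD x y : - (x + y) = - x + - y.
Proof.
apply: (quasi_inv_uniq (@qaddA R) (@qaddC R) (x := x + y)).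
- exact: qaddxxN.
- exact: qaddNNx.
- by rewrite (qaddACA x y x y) (qaddACA (x + x)) !qaddxxN.
- by rewrite (qaddACA (- x) (- y) (- x)) (qaddACA (- x + - x)) !qaddNNx.
Qed.

Lemma qoppK x : - - x = x.
Proof.
apply: (quasi_inv_uniq (@qaddA R) (@qaddC R) (x := - x));
  [exact: qaddxxN | exact: qaddNNx | exact: qaddNNx | exact: qaddxxN].
Qed.

Lemma Eadd_opp a : a \in Eadd R -> - a = a.
Proof.
move=> /EaddP aa; apply: (quasi_inv_uniq (@qaddA R) (@qaddC R) (x := a)).
- exact: qaddxxN.
- exact: qaddNNx.
- by rewrite !aa.
- by rewrite !aa.
Qed.

Lemma qinvM x y : (x * y)^-1 = x^-1 * y^-1.
Proof.
apply: (quasi_inv_uniq (@qmulA R) (@qmulC R) (x := x * y)).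
- exact: qmulxxV.
- exact: qmulVVx.
- by rewrite (qmulACA x y x y) (qmulACA (x * x)) !qmulxxV.
- by rewrite (qmulACA x^-1 y^-1 x^-1) (qmulACA (x^-1 * x^-1)) !qmulVVx.
Qed.

Lemma qinvK x : x^-1^-1 = x.
Proof.
apply: (quasi_inv_uniq (@qmulA R) (@qmulC R) (x := x^-1));
  [exact: qmulxxV | exact: qmulVVx | exact: qmulVVx | exact: qmulxxV].
Qed.

Lemma eaddDr x : x + eadd x = x.
Proof. by rewrite /eadd qaddA qaddxxN. Qed.
Lemma eaddD x y : eadd (x + y) = eadd x + eadd y.
Proof. by rewrite /eadd qoppD qaddACA. Qed.
Lemma eaddN x : eadd (- x) = eadd x.
Proof. by rewrite /eadd qoppK qaddC. Qed.
Lemma eadd_id a : a \in Eadd R -> eadd a = a.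
Proof. by move=> aE; rewrite /eadd Eadd_opp //; apply/EaddP. Qed.
Lemma eadd_Eadd x : eadd x \in Eadd R.
Proof. by apply/EaddP; rewrite {2}/eadd qaddA [_ + x]qaddC eaddDr. Qed.
Lemma eaddK x : eadd (eadd x) = eadd x.
Proof. by rewrite eadd_id // eadd_Eadd. Qed.
Lemma eadd_add x : eadd x + eadd x = eadd x.
Proof. exact/EaddP/eadd_Eadd. Qed.

Lemma qle_refl x : x <= x.
Proof. by apply/qleP; rewrite eaddDr. Qed.
Lemma qle_eadd x y : x <= y -> eadd x <= eadd y.
Proof. by move=> /qleP h; apply/qleP; rewrite {1}h eaddD !eaddK. Qed.
Lemma qle_trans y x z : x <= y -> y <= z -> x <= z.
Proof.
move=> xy /qleP yz; apply/qleP.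
have /qleP := qle_eadd xy; rewrite eaddK => exy.
by move/qleP: xy => xy; rewrite {1}xy {1}yz -qaddA -exy.
Qed.
Lemma qle_eq x y : x <= y -> eadd x = eadd y -> x = y.
Proof. by move=> /qleP h e; rewrite h e eaddDr. Qed.
Lemma qle_add2r z x y : x <= y -> x + z <= y + z.
Proof.
move=> /qleP h; apply/qleP.
by rewrite eaddD {1}h qaddACA eaddDr.
Qed.
Lemma qle_add x y z t : x <= y -> z <= t -> x + z <= y + t.
Proof.
move=> xy zt; apply: (@qle_trans (y + z)); first exact: qle_add2r.
by rewrite ![y + _]qaddC; apply: qle_add2r.
Qed.
Lemma qle_addr x a : a \in Eadd R -> x + a <= x.
Proof.
move=> aE; apply/qleP.
by rewrite eaddD (eadd_id aE) qaddA eaddDr.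
Qed.
Lemma qle_mul x y z t : x <= y -> z <= t -> x * z <= y * t.
Proof.
move=> xy zt; apply: (@qle_trans (x * t)); first exact: qmul_mono.
by rewrite ![_ * t]qmulC; apply: qmul_mono.
Qed.
Lemma Eadd_leE a b : a \in Eadd R -> (a <= b) = (a == b + a).
Proof. by move=> aE; rewrite /qle eadd_id. Qed.
Lemma qle_anti_E a b : a \in Eadd R -> b \in Eadd R -> a <= b -> b <= a -> a = b.
Proof.
move=> aE bE; rewrite !Eadd_leE // => /eqP ab /eqP ba.
by rewrite ab qaddC -ba.
Qed.
Lemma EaddD a b : a \in Eadd R -> b \in Eadd R -> a + b \in Eadd R.
Proof. by move=> /EaddP ha /EaddP hb; apply/EaddP; rewrite qaddACA ha hb. Qed.
Lemma qle_glb c a b : c \in Eadd R -> c <= a -> c <= b -> c <= a + b.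
Proof. by move=> /EaddP cE ca cb; rewrite -cE; apply: qle_add. Qed.
Lemma EaddMl x a : a \in Eadd R -> x * a \in Eadd R.
Proof.
move=> /EaddP aE; apply/EaddP.
have /qleP := qmulD_le x a a.
by rewrite aE eaddD eadd_add eaddDr.
Qed.
Lemma EaddV a : a \in Eadd R -> a^-1 \in Eadd R.
Proof. by move=> aE; rewrite -qmulVVx; apply: EaddMl. Qed.

Lemma eps_Eadd : \eps \in Eadd R.
Proof. by have := Eadd_Emul (\eps : R); rewrite eqxx => /andP[]. Qed.
Lemma eps_Emul : \eps \in Emul R.
Proof. by have := Eadd_Emul (\eps : R); rewrite eqxx => /andP[]. Qed.
Lemma emul_Emul x : emul x \in Emul R.
Proof. by apply/EmulP; rewrite /emul qmulA [_ * _ * x]qmulAC qmulxxV. Qed.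
Lemma emulMr x : x * emul x = x.
Proof. by rewrite /emul qmulA qmulxxV. Qed.
Lemma EmulM a b : a \in Emul R -> b \in Emul R -> a * b \in Emul R.
Proof. by move=> /EmulP ha /EmulP hb; apply/EmulP; rewrite qmulACA ha hb. Qed.

Lemma qdivE a : a \in Eadd R -> a * a^-1 = \eps.
Proof.
move=> aE; apply/eqP; rewrite -Eadd_Emul emul_Emul andbT qmulC.
exact: EaddMl.
Qed.
Lemma qval_id a : a \in Eadd R -> qval a = a.
Proof. by move=> aE; rewrite /qval -(qdivE aE) qmulC emulMr. Qed.
Lemma qmul1E a : a \in Eadd R -> a * \eps = a.
Proof. by move=> aE; rewrite qmulC; apply: qval_id. Qed.
Lemma qval_Eadd x : qval x \in Eadd R.
Proof. by rewrite /qval qmulC EaddMl ?eps_Eadd. Qed.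
Lemma qvalM x y : qval (x * y) = qval x * qval y.
Proof. by rewrite /qval qmulACA (EmulP _ eps_Emul). Qed.
Lemma qmulE x a : a \in Eadd R -> x * a = qval x * a.
Proof. by move=> aE; rewrite -{1}(qval_id aE) /qval qmulA (qmulC x). Qed.
Lemma qle_val x y : x <= y -> qval x <= qval y.
Proof. exact: qmul_mono. Qed.
Lemma qval_Emul x : x \in Emul R -> qval x = \eps.
Proof.
move=> xE; apply/eqP; rewrite -Eadd_Emul qval_Eadd /=.
exact: EmulM eps_Emul xE.
Qed.
Lemma qmulKE a x : a \in Eadd R -> x \in Eadd R -> a^-1 * (a * x) = x.
Proof. by move=> aE xE; rewrite qmulA [_ * a]qmulC qdivE // -/(qval x) qval_id. Qed.
Lemma qmulKVE a x : a \in Eadd R -> x \in Eadd R -> a * (a^-1 * x) = x.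
Proof. by move=> aE xE; rewrite qmulA qdivE // -/(qval x) qval_id. Qed.
Lemma qinv_anti a b : a \in Eadd R -> b \in Eadd R -> a <= b -> b^-1 <= a^-1.
Proof.
move=> aE bE ab; have := qmul_mono (a^-1 * b^-1) ab.
by rewrite [_ * a]qmulC [_ * b]qmulC {2}[a^-1 * _]qmulC !qmulKVE ?EaddV.
Qed.
Lemma qinv_eps : (\eps : R)^-1 = \eps.
Proof. by rewrite -[LHS](qval_id (EaddV eps_Eadd)) /qval qdivE ?eps_Eadd. Qed.

Lemma qmulDE a b c : a \in Eadd R -> b \in Eadd R -> c \in Eadd R ->
  a * (b + c) = a * b + a * c.
Proof.
move=> aE bE cE; apply: qle_anti_E; first exact: EaddMl (EaddD bE cE).
- by apply: EaddD; apply: EaddMl.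
- apply: qle_glb; first exact: EaddMl (EaddD bE cE).
    exact: qmul_mono (qle_addr _ cE).
  by apply: qmul_mono; rewrite qaddC; apply: qle_addr.
- exact: qmulD_le.
Qed.

Lemma eaddM_le x y : eadd (x * y) <= qval x * eadd y.
Proof. by rewrite -qmulE ?eadd_Eadd // /eadd qmulN; apply: qmulD_le. Qed.

Lemma eaddM_val x z : emul x * z = z -> eadd (x * z) = qval x * eadd z.
Proof.
move=> xz; apply: qle_anti_E; rewrite ?eadd_Eadd ?EaddMl ?eadd_Eadd //.
  exact: eaddM_le.
have h := qmul_mono (qval x) (eaddM_le x^-1 (x * z)); move: h.
have -> : x^-1 * (x * z) = z by rewrite qmulA [_ * x]qmulC.
move/qle_trans; apply.
rewrite qmulA -qvalM -/(emul x) qval_Emul ?emul_Emul //.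
by rewrite -/(qval _) qval_id ?eadd_Eadd ?qle_refl.
Qed.

Lemma eadd_val x : eadd x = qval x * eadd (emul x).
Proof. by rewrite -eaddM_val ?emulMr //; apply/EmulP; apply: emul_Emul. Qed.

Lemma eaddM x y : eadd (x * y) = qval x * eadd y + qval y * eadd x.
Proof.
apply: qle_anti_E; rewrite ?eadd_Eadd //.
- by apply: EaddD; rewrite EaddMl ?eadd_Eadd.
- apply: qle_glb; rewrite ?eadd_Eadd ?eaddM_le //.
  by rewrite qmulC eaddM_le.
have eE (u : R) : emul u * emul u = emul u by apply/EmulP; apply: emul_Emul.
have -> : eadd (x * y) = qval x * (qval y * eadd (emul x * emul y)).
  rewrite -eaddM_val; last by rewrite qmulCA eE.
  rewrite [y * _]qmulCA emulMr -eaddM_val; last by rewrite qmulA eE.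
  by rewrite qmulA emulMr.
rewrite {1}(eadd_val x) {1}(eadd_val y).
rewrite [qval y * (qval x * _)]qmulCA.
rewrite -!qmulDE ?eadd_Eadd ?qval_Eadd ?EaddMl ?eadd_Eadd //.
do 2!apply: qmul_mono.
by rewrite qaddC -eaddD; apply: eaddD_le_mul; apply: emul_Emul.
Qed.

Lemma qvalD_ge x y : qval x + qval y <= qval (x + y).
Proof. exact: qmulD_le. Qed.
Lemma qvalN x : qval (- x) = qval x.
Proof. by rewrite /qval -qmulN Eadd_opp // -/(qval x) qval_Eadd. Qed.

End Theory.

Section DirectedTheory.
Variable R : directedCrQsringType.
Implicit Types (x y z a b c d : R).

Lemma eps_le_eadd x : x \in Emul R -> \eps <= eadd x.
Proof.
by move/eps_le_Emul/qle_eadd; rewrite eadd_id ?eps_Eadd.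
Qed.

Lemma eadd_Lam_pos x : x \in Emul R -> eadd x \in Lam_pos R.
Proof. by move=> xE; rewrite inE eadd_Eadd eps_le_eadd. Qed.

Lemma qval_le_eadd x : qval x <= eadd x.
Proof.
rewrite eadd_val; have := qmul_mono (qval x) (eps_le_eadd (emul_Emul x)).
by rewrite qmul1E ?qval_Eadd.
Qed.

Lemma emul_eps d : eadd d = qval d -> d = eadd d.
Proof.
move=> ed; have h : eadd (emul d) = \eps.
  have := eadd_val d; rewrite ed => /(congr1 (fun z : R => (qval d)^-1 * z)).
  rewrite qmulKE ?qval_Eadd ?eadd_Eadd // => <-.
  by rewrite qmulC qdivE ?qval_Eadd.
have hh : \eps = emul d.
  apply: qle_eq; first exact/eps_le_Emul/emul_Emul.
  by rewrite h eadd_id ?eps_Eadd.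
by rewrite -{1}(emulMr d) -hh ed qmulC.
Qed.

Lemma eaddM_Emul x y : x \in Emul R -> y \in Emul R ->
  eadd (x * y) = eadd x + eadd y.
Proof.
move=> xE yE; rewrite eaddM !qval_Emul // -!/(qval _) !qval_id ?eadd_Eadd //.
exact: qaddC.
Qed.

Lemma Emul_sub_le x y : x \in Emul R -> y \in Emul R -> x * y = x -> x <= y.
Proof.
move=> xE yE xy; set d := y + - x.
have ea : eadd x = eadd x + eadd y by rewrite -eaddM_Emul // xy.
have ed : eadd d = eadd x by rewrite eaddD eaddN qaddC -ea.
have vd : \eps <= qval d.
  have := qvalD_ge y (- x); rewrite qvalN (qval_Emul xE) (qval_Emul yE).
  by rewrite (EaddP _ (eps_Eadd R)).
have exd : eadd (x * d) = eadd x.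
  rewrite eaddM ed (qval_Emul xE) -/(qval _) qval_id ?eadd_Eadd //.
  apply: qle_anti_E; [apply: EaddD| | |]; rewrite ?EaddMl ?eadd_Eadd //.
    by apply: qle_addr; rewrite EaddMl ?eadd_Eadd.
  apply: qle_glb; rewrite ?eadd_Eadd ?qle_refl //.
  rewrite -{1}(qval_id (eadd_Eadd x)) /qval [qval d * _]qmulC [\eps * _]qmulC.
  exact: qmul_mono.
have xd : x * d = eadd x.
  apply/esym; apply: qle_eq; last by rewrite eaddK.
  have := qmulD_le x y (- x).
  by rewrite -qmulN xy (EmulP _ xE).
have vdE : eadd d = qval d.
  rewrite ed; have := congr1 (@qval R) xd.
  rewrite qvalM qval_Emul // (qval_id (eadd_Eadd x)) => <-.
  by rewrite -/(qval _) qval_id ?qval_Eadd.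
have dE := emul_eps vdE.
by apply/qleP; rewrite -{1}(eaddDr x) -{1}ed -dE /d qaddCA.
Qed.

Lemma Emul_inj x y : x \in Emul R -> y \in Emul R -> eadd x = eadd y -> x = y.
Proof.
have aux u w : u \in Emul R -> w \in Emul R -> eadd u = eadd w -> u * w = u.
  move=> uE wE uw; apply: qle_eq.
    apply: Emul_sub_le; rewrite ?EmulM //.
    by rewrite qmulAC (EmulP _ uE).
  by rewrite eaddM_Emul // -uw eadd_add.
by move=> xE yE xy; rewrite -(aux x y) // qmulC (aux y x).
Qed.

Lemma Emul_le x y : x \in Emul R -> y \in Emul R -> eadd x <= eadd y -> x <= y.
Proof.
move=> xE yE; rewrite Eadd_leE ?eadd_Eadd // => /eqP xy.
apply: Emul_sub_le => //; apply: Emul_inj; rewrite ?EmulM //.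
by rewrite eaddM_Emul // qaddC -xy.
Qed.

Lemma eadd_emul x : eadd (emul x) = (qval x)^-1 * eadd x.
Proof. by rewrite (eadd_val x) qmulKE ?qval_Eadd ?eadd_Eadd. Qed.

Lemma qvalDE x a : a \in Eadd R -> qval (x + a) = qval x + a.
Proof.
move=> aE; apply: qle_anti_E; rewrite ?EaddD ?qval_Eadd //.
  apply: qle_glb; rewrite ?qval_Eadd //; first exact/qle_val/qle_addr.
  apply: qle_trans (qval_le_eadd _) _.
  by rewrite eaddD (eadd_id aE) qaddC qle_addr ?eadd_Eadd.
by have := qvalD_ge x a; rewrite (qval_id aE).
Qed.

Lemma qmul_trunc x y a d : a \in Eadd R -> d \in Eadd R ->
  a <= eadd (x * y) -> a <= qval y * d -> (x + d) * y + a = x * y + a.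
Proof.
move=> aE dE axy ad; apply: qle_eq.
  by rewrite qle_add2r // ![_ * y]qmulC qmul_mono // qle_addr.
have ayx : a <= eadd (y * x) by rewrite qmulC.
have ea u : a <= eadd u -> eadd (u + a) = a.
  by rewrite eaddD (eadd_id aE) Eadd_leE // => /eqP <-.
rewrite !ea // eaddM qvalDE // eaddD (eadd_id dE).
apply: qle_glb => //; last first.
  rewrite qmulDE ?qval_Eadd ?eadd_Eadd //; apply: qle_glb => //.
  exact: qle_trans ayx (eaddM_le _ _).
rewrite qmulC qmulDE ?qval_Eadd ?eadd_Eadd //; apply: qle_glb => //.
  by rewrite qmulC; apply: qle_trans axy (eaddM_le _ _).
apply: qle_trans ad _; apply: qle_mul; last exact: qle_refl.
exact: qval_le_eadd.
Qed.

End DirectedTheory.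

Record Lam (R : qsAlgType) := MkLam { lval :> R; lvalP : lval \in Lam_pos R }.
HB.instance Definition _ (R : qsAlgType) := [isSub for @lval R].
HB.instance Definition _ (R : qsAlgType) := [Choice of Lam R by <:].

Section LamOps.
Variable R : crQsringType.
Implicit Types a b c : Lam R.

Lemma eps_Lam_pos : \eps \in Lam_pos R.
Proof. by rewrite inE eps_Eadd qle_refl. Qed.
Definition leps : Lam R := MkLam eps_Lam_pos.

Lemma lval_Eadd a : lval a \in Eadd R.
Proof. by have /andP[] := lvalP a. Qed.
Lemma leps_le a : \eps <= lval a.
Proof. by have /andP[] := lvalP a. Qed.

Lemma lmul_subproof a b : lval a * lval b \in Lam_pos R.
Proof.
rewrite inE EaddMl ?lval_Eadd //= -(EmulP _ (eps_Emul R)).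
by apply: qle_mul; apply: leps_le.
Qed.
Definition lmul a b : Lam R := MkLam (lmul_subproof a b).

Lemma lmulA : associative lmul.
Proof. by move=> a b c; apply: val_inj; apply: qmulA. Qed.
Lemma lmulC : commutative lmul.
Proof. by move=> a b; apply: val_inj; apply: qmulC. Qed.
Lemma lmulAC : right_commutative lmul.
Proof. by move=> a b c; rewrite -!lmulA (lmulC b). Qed.
End LamOps.

Definition in_BR (R : crQsringType) (f : Lam R -> R) : Prop :=
  (forall a : Lam R, eadd (f a) = a) /\
  (forall a b : Lam R, lval a <= lval b -> f a <= f b).

Record BR (R : crQsringType) := MkBR {
  bfun :> Lam R -> R;
  bfunP : `[< in_BR bfun >]
}.
HB.instance Definition _ (R : crQsringType) := [isSub for @bfun R].
HB.instance Definition _ (R : crQsringType) := [Choice of BR R by <:].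

Section BRadd.
Variable R : crQsringType.
Implicit Types (f g h : BR R) (a b c : Lam R).

Lemma bfunE f a : eadd (f a) = a.
Proof. by have /asboolP[] := bfunP f. Qed.
Lemma bfun_mono f a b : lval a <= lval b -> f a <= f b.
Proof. by have /asboolP[_] := bfunP f; apply. Qed.

Lemma bfun_eq f g : (forall a, f a = g a) -> f = g.
Proof. by move=> fg; apply: val_inj; apply/funext. Qed.

Lemma badd_subproof f g : `[< in_BR (fun a => f a + g a) >].
Proof.
apply/asboolP; split=> [a|a b ab].
  by rewrite eaddD !bfunE; apply/EaddP/lval_Eadd.
by apply: qle_add; apply: bfun_mono.
Qed.
Definition badd f g : BR R := MkBR (badd_subproof f g).

Lemma bopp_subproof f : `[< in_BR (fun a => - f a) >].
Proof.
apply/asboolP; split=> [a|a b ab]; first by rewrite eaddN bfunE.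
have /qleP h := bfun_mono f ab.
by apply/qleP; rewrite eaddN {1}h qoppD (Eadd_opp (eadd_Eadd _)).
Qed.
Definition bopp f : BR R := MkBR (bopp_subproof f).

Lemma bzero_subproof : `[< in_BR (fun a => lval a) >].
Proof. by apply/asboolP; split=> // a; rewrite eadd_id ?lval_Eadd. Qed.
Definition bzero : BR R := MkBR bzero_subproof.

Lemma baddA : associative badd.
Proof. by move=> f g h; apply: bfun_eq => a; apply: qaddA. Qed.
Lemma baddC : commutative badd.
Proof. by move=> f g; apply: bfun_eq => a; apply: qaddC. Qed.
Lemma badd0 : left_id bzero badd.
Proof. by move=> f; apply: bfun_eq => a /=; rewrite qaddC -(bfunE f) eaddDr. Qed.
Lemma baddN : left_inverse bzero bopp badd.
Proof. by move=> f; apply: bfun_eq => a /=; rewrite qaddC -/(eadd _) bfunE. Qed.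

HB.instance Definition _ :=
  GRing.isZmodule.Build (BR R) baddA baddC badd0 baddN.
End BRadd.

Section BRmul.
Variable R : directedCrQsringType.
Implicit Types (f g h : BR R) (a b c : Lam R).

Lemma lpole_subproof f : (qval (f (leps R)))^-1 \in Lam_pos R.
Proof.
rewrite inE EaddV ?qval_Eadd //= -[X in X <= _]qinv_eps.
rewrite qinv_anti ?qval_Eadd ?eps_Eadd //.
by have := qval_le_eadd (f (leps R)); rewrite bfunE.
Qed.
(* v(f(eps))^-1, which lies in Lambda_+ because v(x) <= e^+(x) *)
Definition lpole f : Lam R := MkLam (lpole_subproof f).

Definition bmul_fun f g : Lam R -> R :=
  fun a => f (lmul a (lpole g)) * g (lmul a (lpole f)) + lval a.

Lemma qval_bfun f a : qval (f (leps R)) <= qval (f a).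
Proof. exact/qle_val/bfun_mono/leps_le. Qed.

Lemma lpole_cancel f a : qval (f (leps R)) * lval (lmul a (lpole f)) = lval a.
Proof. by rewrite /= [lval a * _]qmulC qmulKVE ?qval_Eadd ?lval_Eadd. Qed.

Lemma lpole_le f a b c : lval (lmul a (lpole f)) <= lval c ->
  lval a <= qval (f b) * lval c.
Proof.
by move=> h; rewrite -(lpole_cancel f a); apply: qle_mul h; apply: qval_bfun.
Qed.

Lemma bmul_eadd f g a b c :
  lval (lmul a (lpole g)) <= lval b -> lval (lmul a (lpole f)) <= lval c ->
  lval a <= eadd (f b * g c).
Proof.
move=> hb hc; rewrite eaddM !bfunE.
by apply: qle_glb; [exact: lval_Eadd|exact: lpole_le|exact: lpole_le].
Qed.

Lemma eaddD_lval (x : R) a : lval a <= eadd x -> eadd (x + lval a) = a.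
Proof.
by rewrite eaddD (eadd_id (lval_Eadd a)) Eadd_leE ?lval_Eadd // => /eqP <-.
Qed.

Lemma bmul_funE f g a b c :
  lval (lmul a (lpole g)) <= lval b -> lval (lmul a (lpole f)) <= lval c ->
  bmul_fun f g a = f b * g c + lval a.
Proof.
move=> hb hc; apply: qle_eq.
  by apply: qle_add2r; apply: qle_mul; apply: bfun_mono.
by rewrite !eaddD_lval // bmul_eadd ?qle_refl.
Qed.

Lemma bmul_subproof f g : `[< in_BR (bmul_fun f g) >].
Proof.
apply/asboolP; split=> [a|a b ab].
  by rewrite eaddD_lval // bmul_eadd ?qle_refl.
by apply: qle_add => //; apply: qle_mul; apply: bfun_mono; apply: qle_mul ab _;
  apply: qle_refl.
Qed.
Definition bmul f g : BR R := MkBR (bmul_subproof f g).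

Lemma bmulC : commutative bmul.
Proof. by move=> f g; apply: bfun_eq => a /=; rewrite /bmul_fun qmulC. Qed.

Lemma lpole_bound f g h : qval (f (leps R)) * qval (g (leps R)) <= qval (h (leps R))
  -> lval (lpole h) <= lval (lmul (lpole f) (lpole g)).
Proof.
move=> fgh; rewrite /= -qinvM; apply: qinv_anti fgh; last exact: qval_Eadd.
by apply: EaddMl; apply: qval_Eadd.
Qed.

Lemma lmul_le a b c : lval b <= lval c -> lval (lmul a b) <= lval (lmul a c).
Proof. exact: qmul_mono. Qed.

Lemma qval_eps_le f : qval (f (leps R)) <= \eps.
Proof. by have := qval_le_eadd (f (leps R)); rewrite bfunE. Qed.

Lemma lpole_mul f g : lval (lpole (bmul f g)) <= lval (lmul (lpole f) (lpole g)).
Proof.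
apply: lpole_bound; rewrite /= /bmul_fun qvalDE ?lval_Eadd //.
apply: qle_glb; first by apply: EaddMl; apply: qval_Eadd.
  by rewrite qvalM; apply: qle_mul; apply: qval_bfun.
by rewrite -[lval (leps R)](EmulP _ (eps_Emul R)); apply: qle_mul; apply: qval_eps_le.
Qed.

Lemma bmul3 f g h a :
  bmul (bmul f g) h a =
  f (lmul (lmul a (lpole g)) (lpole h)) * g (lmul (lmul a (lpole f)) (lpole h))
  * h (lmul (lmul a (lpole f)) (lpole g)) + lval a.
Proof.
rewrite /= (bmul_funE (b := lmul a (lpole h))
  (c := lmul (lmul a (lpole f)) (lpole g))) ?qle_refl //; last first.
  by rewrite -lmulA; apply: lmul_le; apply: lpole_mul.
rewrite /= /bmul_fun ![lmul (lmul a (lpole h)) _]lmulAC.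
apply: qmul_trunc; rewrite ?lval_Eadd //; last first.
  by apply: lpole_le; apply: qle_refl.
rewrite eaddM bfunE; apply: qle_glb; rewrite ?lval_Eadd //.
  rewrite qvalM -{1}(lpole_cancel f a) -(lpole_cancel g (lmul a (lpole f))).
  rewrite qmulA; apply: qle_mul; last exact: qle_refl.
  by apply: qle_mul; apply: qval_bfun.
rewrite -{1}(lpole_cancel h a); apply: qle_mul; first exact: qval_bfun.
by apply: bmul_eadd; rewrite lmulAC qle_refl.
Qed.

Lemma bmulA : associative bmul.
Proof.
move=> f g h; rewrite [LHS]bmulC; apply: bfun_eq => a; rewrite !bmul3.
congr (_ + _); rewrite qmulC qmulA (lmulAC a (lpole h) (lpole f)).
by rewrite (lmulAC a (lpole g) (lpole f)).
Qed.

Lemma bmulDl : left_distributive bmul (@badd R).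
Proof.
move=> f g h; apply: bfun_eq => a; apply/esym/qle_eq; last by rewrite !bfunE.
set b := lmul a (lpole h); set c := lmul a (lmul (lpole f) (lpole g)).
have le1 (u : R) (x : Lam R) : u \in Eadd R -> u <= u * lval x.
  by move=> uE; rewrite -{1}(qmul1E uE); apply/qmul_mono/leps_le.
have hf : lval (lmul a (lpole f)) <= lval c.
  by apply: lmul_le; apply: le1; rewrite lval_Eadd.
have hg : lval (lmul a (lpole g)) <= lval c.
  by apply: lmul_le; rewrite lmulC; apply: le1; rewrite lval_Eadd.
rewrite /= [X in _ <= X](bmul_funE (b := b) (c := c)) ?qle_refl //; last first.
  apply: lmul_le; apply: lpole_bound; apply: qle_trans _ (qvalD_ge _ _).
  apply: qle_glb; first by apply: EaddMl; apply: qval_Eadd.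
    rewrite -[X in _ <= X]qmul1E ?qval_Eadd //; apply: qmul_mono.
    exact: qval_eps_le.
  rewrite qmulC -[X in _ <= X]qmul1E ?qval_Eadd //; apply: qmul_mono.
  exact: qval_eps_le.
rewrite (bmul_funE (b := b) (c := c)) ?qle_refl //.
rewrite (bmul_funE (b := b) (c := c)) ?qle_refl //=.
rewrite qaddACA (EaddP _ (lval_Eadd a)); apply: qle_add2r.
by rewrite ![_ * h c]qmulC; apply: qmulD_le.
Qed.
End BRmul.

Section BRring.
Variable R : superrigidType.
Implicit Types (f g h : BR R) (a b c : Lam R).

(* 1_a, the unique multiplicative idempotent with [eadd] equal to [a] *)
Definition qidem a : R := xchoose (eadd_surj (lval a) (lvalP a)).

Lemma qidemE a : eadd (qidem a) = a.
Proof. by have /andP[_ /eqP] := xchooseP (eadd_surj (lval a) (lvalP a)). Qed.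
Lemma qidem_Emul a : qidem a \in Emul R.
Proof. by have /andP[] := xchooseP (eadd_surj (lval a) (lvalP a)). Qed.

Lemma bone_subproof : `[< in_BR qidem >].
Proof.
apply/asboolP; split=> [|a b ab]; first exact: qidemE.
by apply: Emul_le; rewrite ?qidem_Emul // !qidemE.
Qed.
Definition bone : BR R := MkBR bone_subproof.

Lemma bone_eps : bone (leps R) = \eps.
Proof.
apply: Emul_inj; rewrite ?qidem_Emul ?eps_Emul //.
by rewrite qidemE eadd_id ?eps_Eadd.
Qed.

Lemma bmul1 : left_id bone (@bmul R).
Proof.
move=> f; apply: bfun_eq => a; rewrite /= /bmul_fun.
have -> : lmul a (lpole bone) = a.
  apply: val_inj; rewrite /= -[qidem _]/(bone _) bone_eps.
  by rewrite qval_id ?eps_Eadd // qinv_eps qmul1E ?lval_Eadd.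
suff -> : bone (lmul a (lpole f)) * f a = f a by rewrite -(bfunE f a) eaddDr.
rewrite -{1}(emulMr (f a)) [f a * _]qmulC qmulA.
suff -> : bone (lmul a (lpole f)) * emul (f a) = emul (f a).
  by rewrite qmulC emulMr.
have bE b : bone b \in Emul R := qidem_Emul b.
have fE : emul (f a) \in Emul R := emul_Emul (f a).
apply: Emul_inj => //; first exact: EmulM.
rewrite eaddM_Emul // bfunE.
suff /qleP {2}-> : eadd (emul (f a)) <= lmul a (lpole f) by rewrite eaddK.
rewrite eadd_emul bfunE qmulC; apply: qmul_mono.
by rewrite qinv_anti ?qval_Eadd ?qval_bfun.
Qed.

HB.instance Definition _ :=
  GRing.Zmodule_isComPzRing.Build (BR R) (@bmulA R) (@bmulC R) bmul1 (@bmulDl R).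
End BRring.

Definition AR (R : crQsringType) : {pred BR R} :=
  [pred f : BR R | f (leps R) == \eps].
Arguments AR R : clear implicits.

Local Open Scope ring_scope.

(* [{poly B}] needs a nontrivial ring, but B_R is the zero ring when R is
   trivial; so the monic equation of degree n is written out.  The case n = 0
   reads 1 = 0 and only occurs in the zero ring. *)
Definition integral_over (B : comPzRingType) (C : {pred B}) (x : B) : Prop :=
  exists (n : nat) (c : 'I_n -> B),
    (forall i, c i \in C) /\ x ^+ n + \sum_(i < n) c i * x ^+ i = 0.

Definition integrally_closed_in (B : comPzRingType) (C : {pred B}) : Prop :=
  forall x : B, integral_over C x -> x \in C.

(* With the classical axioms of boolp, {pred B} ranges over all subsets of B. *)
Definition prufer_ext (B : comPzRingType) (A : {pred B}) : Prop :=
  forall C : {pred B}, GRing.subring_closed C -> {subset A <= C} ->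
    integrally_closed_in C.

Lemma AR_subring (R : superrigidType) : GRing.subring_closed (AR R).
Proof.
have pole1 (f : BR R) : f \in AR R -> lpole f = leps R.
  move/eqP => f1; apply: val_inj.
  by rewrite /= f1 qval_id ?eps_Eadd // qinv_eps.
have epsM : lmul (leps R) (leps R) = leps R.
  by apply: val_inj; apply/EmulP/eps_Emul.
split=> [|f g fA gA|f g fA gA].
- by rewrite inE; apply/eqP/bone_eps.
- rewrite inE; move/eqP: fA => /= ->; move/eqP: gA => /= ->.
  by rewrite (Eadd_opp (eps_Eadd R)) (EaddP _ (eps_Eadd R)).
- rewrite inE /= /bmul_fun !pole1 // epsM.
  move/eqP: fA => /= ->; move/eqP: gA => /= ->.
  by rewrite (EmulP _ (eps_Emul R)) (EaddP _ (eps_Eadd R)).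
Qed.

Definition prufer_qsring (R : superrigidType) : Prop := prufer_ext (AR R).

(* Main.v *)
(* [A] is Pruefer in [B] iff every [x] in [B] has a [y] in [A] with [x y] and
   [x (1 - x y)] in [A]: closedness of [A[x^2]] puts [x] in [A[x^2]], and
   peeling off leading terms of the resulting equation, using closedness of
   [A], leaves [y x^2 - x + c = 0] with [y], [x y], [c] in [A].  For
   [x = phi] in [B_R] and [gamma = v(phi(eps))^-1], the element
   [phi(gamma)] has valuation [gamma^-1] and precision [gamma], hence relative
   precision [gamma^2]; so both the condition on [y = psi] and
   [psi(gamma^2) <= phi(gamma)^-1] say that [psi] is in [A_R] and
   [phi psi = 1] at precision [gamma]. *)

Require Import Defs.
From HB Require Import structures.
From mathcomp Require Import all_boot ssralg boolp.

Import GRing.Theory.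

(** * Integral elements that admit a witness [y] *)

Section IntegralElements.
Local Open Scope ring_scope.
Variables (B : comPzRingType) (C : {pred B}).
Hypothesis C_subring : GRing.subring_closed C.
HB.instance Definition _ := GRing.isSubringClosed.Build B C C_subring.

(* Multiplying the equation of degree [n.+1] by [y ^+ n] gives
   [x * (x * y) ^+ n \in C], and [x] agrees with [x * (x * y)] up to [C]. *)
Lemma mem_of_integral (x y : B) :
  y \in C -> x * y \in C -> x * (1 - x * y) \in C -> integral_over C x ->
  x \in C.
Proof.
move=> yC xyC xC [n [c [cC h]]].
suff aux k : x * (x * y) ^+ k \in C -> x \in C.
  case: n c cC h => [|n] c cC h.
    (* In degree 0 the equation reads 1 = 0, so x = 0. *)
    by rewrite big_ord0 addr0 in h; rewrite -[x]mul1r -[1](expr0 x) h mul0r rpred0.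
  apply: (aux n).
  have -> : x * (x * y) ^+ n = - \sum_(i < n.+1) c i * (x * y) ^+ i * y ^+ (n - i).
    apply/eqP; rewrite -addr_eq0; apply/eqP.
    have := congr1 (fun z => z * y ^+ n) h.
    rewrite mul0r mulrDl exprS -mulrA -exprMn big_distrl /= => h2.
    rewrite -[RHS]h2; congr (_ + _); apply: eq_bigr => i _.
    by rewrite exprMn -!mulrA -exprD subnKC // -ltnS.
  by rewrite rpredN rpred_sum // => i _; rewrite !rpredM ?rpredX.
elim: k => [|k IH]; first by rewrite mulr1.
move=> h2; apply: IH.
have -> : x * (x * y) ^+ k = x * (x * y) ^+ k.+1 + x * (1 - x * y) * (x * y) ^+ k.
  by rewrite -mulrA -mulrDr exprS mulrBl mul1r addrC subrK.
by rewrite rpredD // rpredM // rpredX.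
Qed.

End IntegralElements.

(** * The elementwise criterion for Prüfer extensions *)

Section PruferCriterion.
Local Open Scope ring_scope.
Variables (B : comPzRingType) (A : {pred B}).
Hypothesis A_subring : GRing.subring_closed A.
HB.instance Definition _ := GRing.isSubringClosed.Build B A A_subring.

(** Multiplying the equation by b^n turns it into a monic one for b x, with coefficients c_i
    b^(n-i). *)
Lemma lead_coef_mul_integral (n : nat) (b x : B) (c : nat -> B) :
  b \in A -> (forall i, c i \in A) ->
  b * x ^+ n.+1 + \sum_(i < n.+1) c i * x ^+ i = 0 ->
  integral_over A (b * x).
Proof.
move=> bA cA h; exists n.+1, (fun i : 'I_n.+1 => c i * b ^+ (n - i)).
split=> [i|]; first by rewrite rpredM ?rpredX.
have := congr1 (fun z => b ^+ n * z) h.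
rewrite mulr0 mulrDr mulrA -exprSr -exprMn big_distrr /= => h2.
rewrite -[RHS]h2; congr (_ + _); apply: eq_bigr => i _.
rewrite exprMn -!mulrA [b ^+ (n - i) * _]mulrA -exprD subnK; last by rewrite -ltnS.
by rewrite mulrCA.
Qed.

Section AdjoinSquare.
Variable x : B.

(** The subring A[x^2] in Horner form, so that its closure properties follow by induction on
    polynomial expressions. *)
Inductive adjoin_sqr : B -> Prop :=
| AdjoinSqrNil : adjoin_sqr 0
| AdjoinSqrCons a z : a \in A -> adjoin_sqr z -> adjoin_sqr (a + x ^+ 2 * z).

Lemma adjoin_sqr_const a : a \in A -> adjoin_sqr a.
Proof. by move/AdjoinSqrCons/(_ AdjoinSqrNil); rewrite mulr0 addr0. Qed.

Lemma adjoin_sqrB y z : adjoin_sqr y -> adjoin_sqr z -> adjoin_sqr (y - z).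
Proof.
move=> Cy; elim: Cy z => [|a y' aA Cy IH] z [|b z' bA Cz].
- by rewrite subr0; apply: AdjoinSqrNil.
- elim: Cz b bA => [|b' {}z' b'A Cz IH] b bA.
    by rewrite mulr0 addr0 sub0r; apply: adjoin_sqr_const; rewrite rpredN.
  rewrite sub0r opprD -mulrN -sub0r.
  by apply: AdjoinSqrCons; [rewrite rpredB ?rpred0|rewrite -sub0r; apply: IH].
- by rewrite subr0; apply: AdjoinSqrCons.
- rewrite opprD addrACA -mulrBr; apply: AdjoinSqrCons; first exact: rpredB.
  exact: IH.
Qed.

Lemma adjoin_sqrD y z : adjoin_sqr y -> adjoin_sqr z -> adjoin_sqr (y + z).
Proof.
move=> Cy Cz; rewrite -[z]opprK -[- z]sub0r; apply: (adjoin_sqrB _ _ Cy).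
exact: adjoin_sqrB AdjoinSqrNil Cz.
Qed.

Lemma adjoin_sqrM y z : adjoin_sqr y -> adjoin_sqr z -> adjoin_sqr (y * z).
Proof.
move=> Cy Cz; elim: Cy => [|a y' aA Cy IH]; first by rewrite mul0r; apply: AdjoinSqrNil.
rewrite mulrDl; apply: adjoin_sqrD; last first.
  by rewrite -mulrA -[X in adjoin_sqr X]add0r; apply: AdjoinSqrCons; rewrite ?rpred0.
elim: Cz => [|b z' bA Cz IHz]; first by rewrite mulr0; apply: AdjoinSqrNil.
by rewrite mulrDr mulrCA; apply: AdjoinSqrCons; rewrite ?rpredM.
Qed.

(** The vanishing linear coefficient is the point: in the equation expressing x itself, it keeps the
    coefficient of x a unit. *)
Lemma adjoin_sqr_even z : adjoin_sqr z -> exists n (c : nat -> B),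
  [/\ forall i, c i \in A, c 1%N = 0 & z = \sum_(i < n.+2) c i * x ^+ i].
Proof.
elim=> [|a {}z aA _ [n [c [cA c1 ->]]]].
  exists 0%N, (fun=> 0); split=> // [i|]; first exact: rpred0.
  by rewrite big1 // => i _; rewrite mul0r.
exists n.+2, (fun i => if i is j.+2 then c j else if i == 0%N then a else 0).
split=> // [[|[|i]]|]; rewrite ?rpred0 //.
rewrite [RHS]big_ord_recl [X in _ = _ + X]big_ord_recl /= mulr1 mul0r add0r big_distrr /=.
congr (_ + _); apply: eq_bigr => i _.
by rewrite mulrCA -exprD.
Qed.

Lemma adjoin_sqr_subring : GRing.subring_closed [pred z : B | `[< adjoin_sqr z >]].
Proof.
split=> [|y z /asboolP Cy /asboolP Cz|y z /asboolP Cy /asboolP Cz].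
- exact/asboolP/adjoin_sqr_const/rpred1.
- exact/asboolP/adjoin_sqrB.
- exact/asboolP/adjoin_sqrM.
Qed.
End AdjoinSquare.

(* Replacing the two top terms [b x^(k+1) + c_k x^k] by [(b x + c_k) x^k] keeps
   the leading coefficient in [A], because [b x] is integral over [A]. *)
Lemma reduce_to_quadratic (k : nat) (b x : B) (c : nat -> B) :
  integrally_closed_in A -> b \in A -> (forall i, c i \in A) ->
  b * x ^+ k.+2 + \sum_(i < k.+2) c i * x ^+ i = 0 ->
  exists2 b', b' \in A & b' * x ^+ 2 + \sum_(i < 2) c i * x ^+ i = 0.
Proof.
move=> Acl; elim: k b => [|k IH] b bA cA h; first by exists b.
apply: (IH (b * x + c k.+2)) => //.
  by rewrite rpredD //; apply/Acl/(lead_coef_mul_integral k.+2 _ _ c).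
rewrite mulrDl -mulrA -exprS -[RHS]h -addrA; congr (_ + _).
by rewrite [RHS]big_ord_recr addrC.
Qed.

Lemma prufer_criterion : prufer_ext A <->
  forall x, exists y, [/\ y \in A, x * y \in A & x * (1 - x * y) \in A].
Proof.
split=> [prufA x|H C C_subring AC x [n [c [cC h]]]].
  have Acl : integrally_closed_in A by apply: prufA.
  have /asboolP/adjoin_sqr_even [n [c [cA c1 xE]]] :
      x \in [pred z : B | `[< adjoin_sqr x z >]].
    apply: (prufA _ (adjoin_sqr_subring x)).
      by move=> a aA; apply/asboolP/adjoin_sqr_const.
    (* x is a root of T^2 - x^2, which is monic over A[x^2]. *)
    exists 2%N, (fun i : 'I_2 => if i == ord0 then - x ^+ 2 else 0); split.
      move=> i; apply/asboolP; case: eqP => _; last exact: AdjoinSqrNil.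
      have -> : - x ^+ 2 = 0 + x ^+ 2 * (- 1) by rewrite mulrN1 add0r.
      by apply: AdjoinSqrCons; [exact: rpred0|apply: adjoin_sqr_const; rewrite rpredN1].
    by rewrite !big_ord_recl big_ord0 /= mulr1 mul0r !addr0 subrr.
  (* Subtracting x from its expansion gives a relation with linear coefficient -1. Starting from
     leading coefficient 0, the reduction leaves b x^2 - x + c_0 = 0, so c_0 = x (1 - x b). *)
  have [] := reduce_to_quadratic n 0 x (fun i => c i - (i == 1%N)%:R) Acl.
  - exact: rpred0.
  - by move=> i; rewrite rpredB // rpred_nat.
  - rewrite mul0r add0r; under eq_bigr do rewrite mulrBl.
    rewrite sumrB -xE !big_ord_recl big1 /=; last by move=> i _; rewrite mul0r.
    by rewrite mul0r mul1r add0r addr0 subrr.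
  move=> b bA; rewrite !big_ord_recl big_ord0 /= c1 subr0 mulr1 sub0r mulN1r addr0 => h.
  have xbA : x * b \in A.
    rewrite mulrC; apply: Acl.
    apply: (lead_coef_mul_integral 1 _ _ (fun i => if i == 0%N then c 0%N else - 1)) => //.
      by move=> i; case: ifP; rewrite ?rpredN1.
    by rewrite !big_ord_recl big_ord0 /= mulr1 mulN1r addr0.
  exists b; split=> //; rewrite mulrBr mulr1 mulrA -expr2 mulrC.
  suff -> : x - b * x ^+ 2 = c 0%N by [].
  by apply/eqP; rewrite subr_eq addrC eq_sym -subr_eq0 -addrA; apply/eqP.
have [y [/AC yC /AC xyC /AC xC]] := H x.
by apply: (mem_of_integral _ C C_subring x y) => //; exists n, c.
Qed.

End PruferCriterion.

(** * Elements of [BR R] evaluated at their own pole *)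

Section Quasiring.
Set Implicit Arguments.
Unset Strict Implicit.
Local Open Scope qs_scope.

Lemma qvalV (R : crQsringType) (x : R) : qval x^-1 = (qval x)^-1.
Proof. by rewrite /qval qinvM qinv_eps. Qed.

Lemma lval_lpole (R : directedCrQsringType) (f : BR R) :
  lval (lpole f) = (qval (f (leps R)))^-1.
Proof. by []. Qed.

Lemma lpole_id (R : directedCrQsringType) (f : BR R) : f \in AR R -> lpole f = leps R.
Proof.
by move/eqP => f1; apply: val_inj; rewrite /= f1 qval_id ?eps_Eadd // qinv_eps.
Qed.

Lemma lmul_eps (R : crQsringType) (a : Lam R) : lmul a (leps R) = a.
Proof. by apply: val_inj; rewrite /= qmul1E ?lval_Eadd. Qed.

Lemma lmul_ge (R : crQsringType) (a b : Lam R) : lval a <= lval (lmul a b).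
Proof. by rewrite -{1}(lmul_eps a); apply/qmul_mono/leps_le. Qed.

Lemma bfunDr (R : crQsringType) (f : BR R) a : f a + lval a = f a.
Proof. by rewrite -(bfunE f a) eaddDr. Qed.

Lemma bfunD_le (R : crQsringType) (f : BR R) a b :
  lval a <= lval b -> f b + lval a = f a.
Proof. by move/(bfun_mono f)/qleP ->; rewrite bfunE. Qed.

Lemma bfun_eps (R : crQsringType) (f : BR R) a : f a + \eps = f (leps R).
Proof. exact: (bfunD_le (a := leps R) f (leps_le a)). Qed.

(* With [t = v (f gamma)], [t <= gamma] and [t + \eps = gamma^-1] say that
   [p = t * gamma] satisfies [\eps <= p <= gamma * gamma] and
   [p + gamma = \eps], whence [p <= (p + gamma) * (p + gamma) = \eps]. *)
Lemma qval_bfun_lpole (R : directedCrQsringType) (f : BR R) :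
  qval (f (lpole f)) = (lval (lpole f))^-1.
Proof.
set g := lpole f; set t := qval (f g).
have gE : lval g \in Eadd R := lval_Eadd g.
have tE : t \in Eadd R := qval_Eadd _.
have tg : t <= lval g by have := qval_le_eadd (f g); rewrite bfunE.
have te : t + \eps = (lval g)^-1.
  by rewrite -qvalDE ?eps_Eadd // bfun_eps lval_lpole qinvK.
pose p := t * lval g.
have pE : p \in Eadd R by apply: EaddMl.
have pg : p + lval g = \eps.
  have := congr1 (fun z => lval g * z) te.
  by rewrite qdivE // qmulDE ?eps_Eadd // qmul1E // qmulC.
have ep : \eps <= p by rewrite -pg; apply: qle_addr.
have pgg : p <= lval g * lval g by apply: qle_mul tg (qle_refl _).
suff pe : p = \eps.
  by have := qmulKE gE tE; rewrite [_ * t]qmulC -/p pe qmul1E ?(EaddV gE) // => <-.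
apply: qle_anti_E; rewrite ?eps_Eadd //.
rewrite -[X in _ <= X](EmulP _ (eps_Emul R)) -pg.
rewrite qmulDE ?EaddD // ![(p + _) * _]qmulC !qmulDE //.
have le1 (u v : R) : u \in Eadd R -> \eps <= v -> u <= u * v.
  by move=> uE ev; rewrite -{1}(qmul1E uE); apply: qmul_mono.
have eg : \eps <= lval g := leps_le g.
apply: qle_glb => //; apply: qle_glb => //; try exact: le1.
by rewrite qmulC; apply: le1.
Qed.

Lemma eadd_emul_lpole (R : directedCrQsringType) (f : BR R) :
  eadd (emul (f (lpole f))) = lmul (lpole f) (lpole f).
Proof. by rewrite eadd_emul qval_bfun_lpole qinvK bfunE. Qed.

Variable R : superrigidType.
Implicit Types f g : BR R.

Lemma emul_bfun_lpole f : emul (f (lpole f)) = bone R (lmul (lpole f) (lpole f)).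
Proof.
apply: Emul_inj; rewrite ?emul_Emul ?qidem_Emul //.
by rewrite eadd_emul_lpole bfunE.
Qed.

Lemma bmul_lpole f g : g \in AR R ->
  (f * g)%R (lpole f) = f (lpole f) * g (lmul (lpole f) (lpole f)) + lval (lpole f).
Proof. by move=> gA; rewrite -[LHS]/(_ * _ + _) (lpole_id gA) lmul_eps. Qed.

(* The second membership says that [1 - f * g] has valuation at least
   [lpole f] at precision [lpole f], i.e. it vanishes there. *)
Lemma bmul_lpole_one f g : (1 - f * g)%R \in AR R ->
  (f * (1 - f * g))%R \in AR R -> (f * g)%R (lpole f) = bone R (lpole f).
Proof.
set c := lpole f; set d := (1 - f * g)%R => dA.
rewrite inE -[(f * d)%R _]/(_ * _ + _) (lpole_id dA) lmul_eps -/c lmulC lmul_eps.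
move/eqP/(congr1 (@qval R)); rewrite qvalDE ?eps_Eadd // qvalM => vfd.
have cE : lval c \in Eadd R := lval_Eadd c.
have dc : d c = lval c.
  suff dE : eadd (d c) = qval (d c) by rewrite (emul_eps dE) bfunE.
  rewrite bfunE; apply: qle_anti_E; rewrite ?qval_Eadd //; last first.
    by have := qval_le_eadd (d c); rewrite bfunE.
  have : \eps <= (lval c)^-1 * qval (d c).
    rewrite lval_lpole qinvK; move: vfd; rewrite (qval_id (eps_Eadd R)) => {1}<-.
    by apply: qle_addr; apply: eps_Eadd.
  by move/(qmul_mono (lval c)); rewrite qmul1E // qmulKVE ?qval_Eadd.
have := congr1 (fun z => z + (f * g)%R c) dc.
rewrite -[d c]/(bone R c + - (f * g)%R c) -qaddA [- _ + _]qaddC -/(eadd _) bfunE.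
by rewrite bfunDr [lval c + _]qaddC bfunDr => ->.
Qed.

(** With x = f(c), both 1_(c^2) = x^-1 x and c^2 = x^-1 c carry the factor x^-1. Pulling it out of
    g(c^2) = 1_(c^2) g(c^2) + c^2 by subdistributivity bounds g(c^2) by x^-1 (f g)(c) = x^-1 1_c,
    and 1_c <= 1_(c^2). *)
Lemma bmul_one_le_inv f g : g \in AR R -> (f * g)%R (lpole f) = bone R (lpole f) ->
  g (lmul (lpole f) (lpole f)) <= (f (lpole f))^-1.
Proof.
set c := lpole f; set x := f c; set cc := lmul c c => gA fg1.
have -> : g cc = bone R cc * g cc + lval cc.
  rewrite -{1}[g]mul1r -[LHS]/(_ * _ + _) (lpole_id gA) lpole_id ?lmul_eps //.
  by have [] := AR_subring R.
have -> : lval cc = x^-1 * lval c.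
  rewrite qmulE ?lval_Eadd //; congr (_ * _).
  by rewrite qvalV qval_bfun_lpole qinvK.
have -> : bone R cc = x^-1 * x by rewrite -emul_bfun_lpole /emul qmulC.
rewrite -qmulA; apply: qle_trans (qmulD_le _ _ _) _.
rewrite -bmul_lpole // fg1.
rewrite -[X in _ <= X]emulMr; apply: qmul_mono.
rewrite /emul qinvK qmulC -/(emul x) emul_bfun_lpole.
exact/bfun_mono/lmul_ge.
Qed.

(** Truncating at [\eps] gives g(eps) = f(c)^-1 + eps, of value c + eps = eps. Value and precision
    then agree, which forces g(eps) = eps. *)
Lemma le_inv_AR f g : g (lmul (lpole f) (lpole f)) <= (f (lpole f))^-1 ->
  g \in AR R.
Proof.
set c := lpole f => gf.
suff /emul_eps ge : eadd (g (leps R)) = qval (g (leps R)).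
  by rewrite inE ge bfunE.
have vinv : qval (f c)^-1 = lval c.
  by rewrite qvalV qval_bfun_lpole qinvK.
rewrite bfunE; apply: qle_anti_E; rewrite ?eps_Eadd ?qval_Eadd //; last exact: qval_eps_le.
have -> : g (leps R) = (f c)^-1 + \eps.
  apply: qle_eq.
    rewrite -(bfun_eps g (lmul c c)); exact: qle_add2r.
  rewrite bfunE eaddD (eadd_id (eps_Eadd R)).
  apply/eqP; rewrite -Eadd_leE ?eps_Eadd //.
  have := qle_eadd gf; rewrite bfunE; apply: qle_trans; exact: leps_le.
rewrite qvalDE ?eps_Eadd // vinv; apply: qle_glb; rewrite ?eps_Eadd ?qle_refl //.
exact: leps_le.
Qed.

(** Multiplying the hypothesis by f(c) bounds (f g)(c) by 1_(c^2) + c = 1_c; comparable elements of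
    equal precision coincide. *)
Lemma le_inv_one f g : g (lmul (lpole f) (lpole f)) <= (f (lpole f))^-1 ->
  (f * g)%R (lpole f) = bone R (lpole f).
Proof.
move=> gf; have gA := le_inv_AR gf.
apply: qle_eq; last by rewrite !bfunE.
rewrite bmul_lpole //.
apply: qle_trans (qle_add2r _ (qmul_mono _ gf)) _.
rewrite -/(emul _) emul_bfun_lpole.
by rewrite (bfunD_le _ (lmul_ge _ _)) qle_refl.
Qed.

End Quasiring.

Local Open Scope qs_scope.

Theorem corollary6p7 (R : superrigidType) :
  prufer_qsring R <->
  forall phi : BR R, exists psi : BR R,
    let gamma : Lam R := lpole phi in
    psi (lmul gamma gamma) <= (phi gamma)^-1.
Proof.
have AR_criterion := prufer_criterion _ _ (AR_subring R).
have [A1 AB _] := AR_subring R.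
split=> [/AR_criterion H phi|H].
  have [psi [psiA fgA ffA]] := H phi; exists psi.
  apply: bmul_one_le_inv psiA _; apply: bmul_lpole_one ffA.
  exact: AB.
apply/AR_criterion => phi; have [psi le_inv] := H phi.
have fg1 := le_inv_one le_inv; exists psi.
have psiA := le_inv_AR le_inv.
have fgA : (phi * psi)%R \in AR R.
  by rewrite inE -(bfun_eps _ (lpole phi)) fg1 bfun_eps bone_eps.
(* Since 1 - phi psi has trivial pole and equals gamma at gamma, the product at [\eps] is phi(eps)
   gamma + eps, and phi(eps) gamma = eps by the choice of gamma. *)
split=> //; rewrite inE -[(phi * _)%R _]/(_ * _ + _).
rewrite (lpole_id (AB _ _ A1 fgA)) lmul_eps lmulC lmul_eps.
rewrite -[(1 - phi * psi)%R _]/(bone R _ + - (phi * psi)%R _) fg1 -/(eadd _) bfunE.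
rewrite qmulE ?lval_Eadd // lval_lpole qdivE ?qval_Eadd //.
by rewrite (EaddP _ (eps_Eadd R)).
Qed.
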